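(* Let $n\ge 2$ be an integer and let $\gamma:S^1=\mathbb{R}/2\pi\mathbb{Z}\to\mathbb{R}^n$ be a non-co-orientable closed frontal. Then its total absolute curvature satisfies $K(\gamma)\ge \pi$. Moreover, $K(\gamma)=\pi$ if and only if $\gamma$ is planar (its image lies in a $2$-dimensional affine plane) and, regarded as a frontal in $\mathbb{R}^2$ by an isometric identification of that plane with $\mathbb{R}^2$, it is locally $L$-convex and its rotation index is equal to $1/2$ or $-1/2$.
   Context: A curve is a smooth ($C^\infty$) map $\gamma:I\to\mathbb{R}^n$ on a non-empty interval $I$ whose set of regular points $\operatorname{Reg}(\gamma)=\{t\in I:\gamma'(t)\neq 0\}$ is dense in $I$. A curve $\gamma$ is a frontal if there is a smooth map $\boldsymbol{e}:I\to S^{n-1}$ ($S^{n-1}$ the unit sphere of $\mathbb{R}^n$) such that $\gamma'(t)$ and $\boldsymbol{e}(t)$ are linearly dependent for every $t\in I$; such an $\boldsymbol{e}$ is called a unit tangent vector field along $\gamma$ (it is unique up to a global sign). A closed frontal is a frontal $\gamma:\mathbb{R}\to\mathbb{R}^n$ that is periodic, normalized to be $2\pi$-periodic, so its domain is regarded as $S^1=\mathbb{R}/2\pi\mathbb{Z}$. It is non-co-orientable if $\boldsymbol{e}(t+2\pi)=-\boldsymbol{e}(t)$ for all $t\in\mathbb{R}$, where $\boldsymbol{e}:\mathbb{R}\to S^{n-1}$ is its unit tangent vector field. On $\operatorname{Reg}(\gamma)$ the curvature function is $k=\sqrt{\|\gamma'\|^2\|\gamma''\|^2-(\gamma'\cdot\gamma'')^2}/\|\gamma'\|^3=\|\boldsymbol{e}'\|/\|\gamma'\|$,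 and with $ds=\|\gamma'\|\,dt$ the curvature measure $k\,ds=\|\boldsymbol{e}'(t)\|\,dt$ is a continuous $1$-form, also at singular points. The total absolute curvature of a closed frontal is $K(\gamma)=\int_{S^1}k\,ds=\int_0^{2\pi}\|\boldsymbol{e}'(t)\|\,dt$. For a frontal $\gamma$ in $\mathbb{R}^2$ put $\tilde\kappa(t)=\det(\boldsymbol{e}(t),\boldsymbol{e}'(t))$. The frontal is locally $L$-convex if either $\tilde\kappa\ge 0$ on its whole domain or $\tilde\kappa\le 0$ on its whole domain. For a non-co-orientable closed frontal in $\mathbb{R}^2$ write $\boldsymbol{e}(t)=(\cos\theta(t),\sin\theta(t))$ with $\theta$ a smooth function on $[0,2\pi]$; since $\boldsymbol{e}(2\pi)=-\boldsymbol{e}(0)$ there is $m\in\mathbb{Z}$ with $\theta(2\pi)-\theta(0)=(2m+1)\pi$, and the rotation index of $\gamma$ is the half-integer $\operatorname{ind}_\gamma=m+\tfrac12$, i.e. $2\pi\operatorname{ind}_\gamma=\theta(2\pi)-\theta(0)$. *)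

(* Defs.v *)
From HB Require Import structures.
From mathcomp Require Import all_boot all_order all_algebra.
From mathcomp Require Import all_classical all_reals all_analysis.

Set Implicit Arguments.
Unset Strict Implicit.
Unset Printing Implicit Defensive.

Import Order.TTheory GRing.Theory Num.Theory.
Import numFieldNormedType.Exports.

Local Open Scope ring_scope.
Local Open Scope classical_set_scope.

(* The library norm on ['rV[R]_n] is the sup norm; it is used here only through
   its topology, and lengths are measured with [enorm]. *)
Definition enorm (R : realType) (n : nat) (v : 'rV[R]_n) : R :=
  Num.sqrt (\sum_(i < n) v 0 i ^+ 2).

Definition smooth (R : realType) (V : normedModType R) (f : R -> V) : Prop :=
  forall (k : nat) (t : R), derivable (f^`(k)) t 1.

(* All curves are defined on the whole line; a closed one is represented by its
   2 pi-periodic lift. *)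
Definition curve (R : realType) (n : nat) (gamma : R -> 'rV[R]_n) : Prop :=
  smooth gamma /\ dense [set t : R | gamma^`() t != 0].

Definition unit_tangent (R : realType) (n : nat) (gamma e : R -> 'rV[R]_n) :
    Prop :=
  [/\ smooth e,
      forall t, enorm (e t) = 1 &
      forall t, ~~ free [:: gamma^`() t; e t]].

Definition frontal (R : realType) (n : nat) (gamma : R -> 'rV[R]_n) : Prop :=
  curve gamma /\ exists e : R -> 'rV[R]_n, unit_tangent gamma e.

Definition closed_frontal (R : realType) (n : nat) (gamma : R -> 'rV[R]_n) :
    Prop :=
  frontal gamma /\ forall t, gamma (t + 2 * pi) = gamma t.

(* The notions below are properties of a frontal expressed through a unit
   tangent field [e] along it.  Such a field is unique up to a global sign;
   replacing [e] by [- e] leaves all of them unchanged. *)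
Definition non_co_orientable (R : realType) (n : nat) (e : R -> 'rV[R]_n) :
    Prop :=
  forall t, e (t + 2 * pi) = - e t.

(* The curvature measure k ds extends continuously over the singular points of
   the frontal as |e'(t)| dt, which is what is integrated. *)
Definition total_abs_curvature (R : realType) (n : nat) (e : R -> 'rV[R]_n) :
    R :=
  \int[lebesgue_measure]_(t in `[0, 2 * pi]) enorm (e^`()%classic t).

Definition kappa_tilde (R : realType) (e : R -> 'rV[R]_2) (t : R) : R :=
  \det (col_mx (e t) (e^`()%classic t) : 'M[R]_2).

Definition locally_L_convex (R : realType) (e : R -> 'rV[R]_2) : Prop :=
  (forall t, 0 <= kappa_tilde e t) \/ (forall t, kappa_tilde e t <= 0).

(* [rotation_index e r]: r is the rotation index of a planar non-co-orientable
   closed frontal with unit tangent field e.  A smooth function on [0, 2 pi] is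
   given as the restriction of one on R. *)
Definition rotation_index (R : realType) (e : R -> 'rV[R]_2) (r : R) : Prop :=
  exists theta : R -> R,
    [/\ smooth (theta : R -> R^o),
        forall t, 0 <= t <= 2 * pi ->
          e t 0 0 = cos (theta t) /\ e t 0 1 = sin (theta t) &
        2 * pi * r = theta (2 * pi) - theta 0].

Definition affine_plane (R : realType) (n : nat) (P : set 'rV[R]_n) : Prop :=
  exists (p : 'rV[R]_n) (W : 'M[R]_(2, n)),
    \rank W = 2%N /\ P = [set x | (x - p <= W)%MS].

Definition isometric_identification (R : realType) (n : nat)
    (phi : 'rV[R]_2 -> 'rV[R]_n) (P : set 'rV[R]_n) : Prop :=
  (forall x y, enorm (phi x - phi y) = enorm (x - y)) /\ range phi = P.

(* Main.v *)
Require Import Defs.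
From HB Require Import structures.
From mathcomp Require Import all_boot all_order all_algebra.
From mathcomp Require Import all_classical all_reals all_analysis.
From mathcomp Require Import ring lra.

Set Implicit Arguments.
Unset Strict Implicit.
Unset Printing Implicit Defensive.

Import Order.TTheory GRing.Theory Num.Theory.
Import numFieldNormedType.Exports.

Local Open Scope ring_scope.
Local Open Scope classical_set_scope.

(** The unit tangent field [e] is a curve on the unit sphere, and
    [total_abs_curvature e] is the length of its arc over one period.
    Non-co-orientability says that this arc joins [e 0] to the antipode
    [- e 0], so its length is at least the spherical distance [pi].

    Lengths are handled through a primitive [L] of the speed [enorm (e' t)].
    Everything about minimality follows from one comparison,
    [cos_length_le]: along an arc of length [L b - L a <= pi], the cosine of
    the angle between the end points is at least [cos (L b - L a)].  It comes
    from the monotonicity of [asin <e t, v> + L t] for a unit vector [v]; the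
    factor [r < 1] in [asin_dot_homo] keeps the argument of [asin] away from
    the points where [asin] is not differentiable.

    If the total length is exactly [pi], let [y] be the value of [e] at the
    parameter where half of the length has been covered.  The comparison from
    both ends gives [<e t, e 0> = cos (L t)], and the comparison with the
    middle gives [<e t, y> >= sin (L t)].  Since [e 0] and [y] are orthonormal
    and [e t] is a unit vector, Bessel's inequality leaves no room:
    [e t = cos (L t) e 0 + sin (L t) y] ([antipodal_geodesic]).  The velocity
    of [gamma] is a multiple of [e], so [gamma] stays in the affine plane
    through [gamma 0] directed by [e 0] and [y].  In the coordinates of that
    frame [L] is an angle function of the tangent field, hence the signed
    curvature is [L' >= 0] and the rotation index is [1 / 2].

    Conversely, an isometric embedding of the plane is affine, and it carries
    the plane tangent field to [e] up to a constant sign.  Thus both fields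
    have the same speed, which is the absolute value of the signed curvature.
    Local L-convexity lets the absolute value be pulled out of the integral,
    whose value is then the total variation of the angle, [2 pi * (1 / 2)]. *)

(** * The Euclidean inner product of row vectors *)

Section Dot.
Context {R : realType}.

Definition dot n (u v : 'rV[R]_n) : R := \sum_(i < n) u 0 i * v 0 i.

Lemma dotC n (u v : 'rV[R]_n) : dot u v = dot v u.
Proof. by apply: eq_bigr => i _; rewrite mulrC. Qed.

Lemma dotDl n (u v w : 'rV[R]_n) : dot (u + v) w = dot u w + dot v w.
Proof. by rewrite -big_split; apply: eq_bigr => i _; rewrite mxE mulrDl. Qed.

Lemma dotZl n a (u v : 'rV[R]_n) : dot (a *: u) v = a * dot u v.
Proof. by rewrite mulr_sumr; apply: eq_bigr => i _; rewrite mxE mulrA. Qed.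

Lemma dotNl n (u v : 'rV[R]_n) : dot (- u) v = - dot u v.
Proof. by rewrite -scaleN1r dotZl mulN1r. Qed.

Lemma dotBl n (u v w : 'rV[R]_n) : dot (u - v) w = dot u w - dot v w.
Proof. by rewrite dotDl dotNl. Qed.

Lemma dotDr n (u v w : 'rV[R]_n) : dot w (u + v) = dot w u + dot w v.
Proof. by rewrite dotC dotDl !(dotC w). Qed.

Lemma dotZr n a (u v : 'rV[R]_n) : dot v (a *: u) = a * dot v u.
Proof. by rewrite dotC dotZl dotC. Qed.

Lemma dot0r n (u : 'rV[R]_n) : dot u 0 = 0.
Proof. by rewrite -(scale0r 0) dotZr mul0r. Qed.

Lemma dotNr n (u v : 'rV[R]_n) : dot v (- u) = - dot v u.
Proof. by rewrite dotC dotNl dotC. Qed.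

Lemma dotBr n (u v w : 'rV[R]_n) : dot w (u - v) = dot w u - dot w v.
Proof. by rewrite dotDr dotNr. Qed.

Definition dotE := (dotDl, dotDr, dotBl, dotBr, dotZl, dotZr, dotNl, dotNr).

Lemma dot_mulmx n m (u : 'rV[R]_n) (v : 'rV[R]_m) (A : 'M[R]_(n, m)) :
  dot (u *m A) v = dot u (v *m A^T).
Proof.
rewrite /dot; under eq_bigr do rewrite mxE mulr_suml.
rewrite exchange_big; apply: eq_bigr => i _ /=; rewrite mxE mulr_sumr.
by apply: eq_bigr => j _; rewrite mxE; ring.
Qed.

Lemma dot_ge0 n (u : 'rV[R]_n) : 0 <= dot u u.
Proof. by apply: sumr_ge0 => i _; rewrite -expr2 sqr_ge0. Qed.

Lemma dot_eq0 n (u : 'rV[R]_n) : dot u u = 0 -> u = 0.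
Proof.
move=> /eqP; rewrite psumr_eq0 => [/allP h|i _]; last by rewrite -expr2 sqr_ge0.
apply/rowP => i; rewrite mxE; apply/eqP.
by have := h i (mem_index_enum _); rewrite mulf_eq0 orbb.
Qed.

Lemma enormE n (u : 'rV[R]_n) : enorm u = Num.sqrt (dot u u).
Proof. by rewrite /enorm; congr Num.sqrt; apply: eq_bigr => i _. Qed.

Lemma enorm_sqr n (u : 'rV[R]_n) : enorm u ^+ 2 = dot u u.
Proof. by rewrite enormE sqr_sqrtr // dot_ge0. Qed.

Lemma enorm_ge0 n (u : 'rV[R]_n) : 0 <= enorm u.
Proof. exact: sqrtr_ge0. Qed.

Lemma enormN n (u : 'rV[R]_n) : enorm (- u) = enorm u.
Proof. by rewrite !enormE !dotE opprK. Qed.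

Lemma dot_CauchySchwarz n (u v : 'rV[R]_n) :
  dot u v ^+ 2 <= dot u u * dot v v.
Proof.
have [v0|v0] := eqVneq (dot v v) 0.
  by rewrite (dot_eq0 v0) !dot0r mulr0 expr0n.
have v_gt0 : 0 < dot v v by rewrite lt_def v0 dot_ge0.
have := dot_ge0 (dot v v *: u - dot u v *: v).
rewrite !dotE (dotC v u) => h.
rewrite -subr_ge0 -(pmulr_rge0 _ v_gt0); apply: le_trans h _.
by rewrite le_eqVlt; apply/orP; left; apply/eqP; ring.
Qed.

Lemma dot_unit n (u : 'rV[R]_n) : enorm u = 1 -> dot u u = 1.
Proof. by rewrite -enorm_sqr => ->; rewrite expr1n. Qed.

Lemma dot_unit_le1 n (u v : 'rV[R]_n) : enorm u = 1 -> enorm v = 1 ->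
  -1 <= dot u v <= 1.
Proof.
move=> u1 v1; have := dot_CauchySchwarz u v.
by rewrite !dot_unit // mulr1 => h; apply/andP; split; nra.
Qed.

End Dot.

(** * Derivatives and smoothness *)

Section Derivatives.
Context {R : realType}.

Lemma is_derive_mxP m n (M : R -> 'M[R]_(m, n)) (t : R) (D : 'M[R]_(m, n)) :
  is_derive t 1 M D <-> forall i j, is_derive t 1 (fun x => M x i j) (D i j).
Proof.
split=> [[dM <-] i j|h].
  apply: DeriveDef; first by have /derivable_mxP := dM; apply.
  by rewrite derive_mx // mxE.
have dM : derivable M t 1.
  by apply/derivable_mxP => i j; have [] := h i j.
apply: DeriveDef => //; rewrite derive_mx //; apply/matrixP => i j.
by rewrite mxE; have [_ ->] := h i j.
Qed.

Lemma is_derive_fun_sum (I : Type) (r : seq I) (F : I -> R -> R) (D : I -> R)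
    (t : R) :
  (forall i, is_derive t 1 (F i) (D i)) ->
  is_derive t 1 (fun x => \sum_(i <- r) F i x) (\sum_(i <- r) D i).
Proof.
move=> h; elim: r => [|i r IHr].
  under eq_fun do rewrite big_nil.
  by rewrite big_nil; exact: is_derive_cst.
under eq_fun do rewrite big_cons.
by rewrite big_cons; exact: is_deriveD.
Qed.

Lemma is_derive_mulmxr m n p (A : 'M[R]_(n, p)) (f : R -> 'M[R]_(m, n))
    (t : R) D :
  is_derive t 1 f D -> is_derive t 1 (fun x => f x *m A) (D *m A).
Proof.
move=> /is_derive_mxP h; apply/is_derive_mxP => i j; rewrite mxE.
under eq_fun do rewrite mxE.
apply: is_derive_fun_sum => k.
have := h i k => {}h.
have := is_deriveM h (is_derive_cst (A k j) t 1).
by move/is_derive_eq; apply; rewrite scaler0 add0r /= mulrC.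
Qed.

Lemma is_derive_dot n (f g : R -> 'rV[R]_n) (t : R) Df Dg :
  is_derive t 1 f Df -> is_derive t 1 g Dg ->
  is_derive t 1 (fun x => dot (f x) (g x)) (dot Df (g t) + dot (f t) Dg).
Proof.
move=> /is_derive_mxP hf /is_derive_mxP hg.
rewrite /dot -big_split; apply: is_derive_fun_sum => k.
have := is_deriveM (hf 0 k) (hg 0 k).
by move/is_derive_eq; apply; rewrite /= addrC [_ *: Df _ _]mulrC.
Qed.

Lemma is_derive_derive1 (V : normedModType R) (f : R -> V) (t : R) (D : V) :
  is_derive t 1 f D -> f^`() t = D.
Proof. by move=> [_ <-]; rewrite derive1E. Qed.

Lemma is_derive_continuous (f g : R -> R) :
  (forall t : R, is_derive t 1 f (g t)) -> continuous f.
Proof.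
move=> h t; apply/differentiable_continuous/derivable1_diffP.
by have [] := h t.
Qed.

Lemma is_derive_eq_sub (f g h : R -> R) :
  (forall t : R, is_derive t 1 f (h t)) ->
  (forall t : R, is_derive t 1 g (h t)) ->
  forall x y, f x - g x = f y - g y.
Proof.
move=> df dg x y; apply: (@is_derive_0_is_cst _ (fun t => f t - g t)) => t.
by have := is_deriveB (df t) (dg t); rewrite subrr.
Qed.

Lemma is_derive_ge0_homo (f g : R -> R) :
  (forall t : R, is_derive t 1 f (g t)) -> (forall t, 0 <= g t) ->
  {homo f : x y / x <= y}.
Proof.
move=> df g0 x y xy.
have cf := is_derive_continuous df.
apply: (@ger0_derive1_le_cc _ f x y) => //.
- by move=> t _; rewrite (is_derive_derive1 (df t)).
- exact: continuous_subspaceT.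
- by rewrite in_itv /= lexx.
- by rewrite in_itv /= lexx andbT.
Qed.

Lemma smooth_is_derive (V : normedModType R) (f : R -> V) (t : R) :
  smooth f -> is_derive t 1 f (f^`() t).
Proof. by move=> /(_ 0 t) df; apply: DeriveDef => //; rewrite derive1E. Qed.

Lemma derive1_mulmxr n m (A : 'M[R]_(n, m)) (f : R -> 'rV[R]_n) t :
  smooth f -> (fun t => f t *m A)^`()%classic t = f^`()%classic t *m A.
Proof.
move=> sf; apply: is_derive_derive1; apply: is_derive_mulmxr.
exact: smooth_is_derive.
Qed.

Lemma smooth_derive1 (V : normedModType R) (f : R -> V) :
  smooth f -> smooth f^`().
Proof. by move=> sf k t; rewrite -derive1Sn; exact: sf. Qed.

(** Smoothness is coinductive in nature: it follows from any class of
    differentiable functions that is stable under derivation.  This replaces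
    Leibniz-type formulas for iterated derivatives. *)
Lemma smooth_coind (V : normedModType R) (S : (R -> V) -> Prop) :
  (forall f, S f -> (forall t, derivable f t 1) /\ S f^`()) ->
  forall f, S f -> smooth f.
Proof.
move=> hS f Sf k t; elim: k f Sf => [|k IHk] f /hS[df Sf'].
  by rewrite derive1n0.
by rewrite derive1Sn; exact: IHk.
Qed.

Lemma smooth_mulmxr n p (A : 'M[R]_(n, p)) (f : R -> 'rV[R]_n) :
  smooth f -> smooth (fun t => f t *m A).
Proof.
pose S h := exists2 f : R -> 'rV[R]_n, smooth f & h = (fun t => f t *m A).
move=> sf; apply: (@smooth_coind _ S); last by exists f.
move=> _ [g sg ->].
have dg t := is_derive_mulmxr A (smooth_is_derive t sg).
split; first by move=> t; have [] := dg t.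
exists g^`(); first exact: smooth_derive1.
by apply/funext => t; rewrite (is_derive_derive1 (dg t)).
Qed.

(** The derivative of an inner product is a sum of two inner products, so
    the class to be used with [smooth_coind] is the closure of inner products
    under addition. *)
Inductive dot_sum n : (R -> R^o) -> Prop :=
| DotSum1 (f g : R -> 'rV[R]_n) : smooth f -> smooth g ->
    dot_sum n (fun t => dot (f t) (g t))
| DotSumD h k : dot_sum n h -> dot_sum n k -> dot_sum n (fun t => h t + k t).

Lemma smooth_dot n (f g : R -> 'rV[R]_n) :
  smooth f -> smooth g -> smooth (fun t => dot (f t) (g t) : R^o).
Proof.
move=> sf sg; apply: (@smooth_coind _ (@dot_sum n)); last exact: DotSum1.
move=> h0; elim=> [{f sf} f {g sg} g sf sg|h k _ [dh Sh] _ [dk Sk]].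
  have dfg t := is_derive_dot (smooth_is_derive t sf) (smooth_is_derive t sg).
  split; first by move=> t; have [] := dfg t.
  have -> := funext (fun t => is_derive_derive1 (dfg t)).
  exact: DotSumD (DotSum1 (smooth_derive1 sf) sg)
                 (DotSum1 sf (smooth_derive1 sg)).
have dhk (t : R) : is_derive t 1 (fun t => h t + k t)
    (h^`()%classic t + k^`()%classic t).
  by apply: is_deriveD; apply: DeriveDef; rewrite ?derive1E.
split; first by move=> t; have [] := dhk t.
have -> := funext (fun t => is_derive_derive1 (dhk t)).
exact: DotSumD Sh Sk.
Qed.

Lemma smooth_primitive (f g : R -> R^o) :
  (forall t : R, is_derive t 1 f (g t)) -> smooth g -> smooth f.
Proof.
move=> df sg.
apply: (@smooth_coind _ (fun h => h = f \/ smooth h)); last by left.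
move=> h [->|sh]; last first.
  by split; [exact: sh 0|right; exact: smooth_derive1].
split; first by move=> t; have [] := df t.
right; rewrite (_ : f^`() = g) //.
by apply/funext => t; rewrite (is_derive_derive1 (df t)).
Qed.

End Derivatives.

(** * Primitives of continuous functions *)

Section Primitive.
Context {R : realType}.
Local Notation mu := (@lebesgue_measure R).

Lemma continuous_integrable_cc (f : R -> R) (a b : R) : continuous f ->
  mu.-integrable `[a, b] (EFin \o f).
Proof.
move=> cf; apply: continuous_compact_integrable; first exact: segment_compact.
exact: continuous_subspaceT.
Qed.

Lemma Rintegral_is_derive (f F : R -> R) (a b : R) : a < b -> continuous f ->
  continuous F -> (forall t : R, a < t < b -> is_derive t 1 F (f t)) ->
  \int[mu]_(t in `[a, b]) f t = F b - F a.
Proof.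
move=> ab cf cF dF.
rewrite /Rintegral (@continuous_FTC2 _ f F) //.
- exact: continuous_subspaceT.
- split; first by move=> x; rewrite in_itv => /dF[].
  + by apply: cvg_at_right_filter; exact: cF.
  + by apply: cvg_at_left_filter; exact: cF.
- by move=> x; rewrite in_itv => /dF /is_derive_derive1.
Qed.

(** The fundamental theorem of calculus differentiates an integral with a
    fixed lower end [a], to the right of [a] only.  Gluing the integrals from
    [0] and to [0] gives a primitive on the whole line: near [t] it coincides
    with the integral from some [a < min t 0], up to a constant. *)
Lemma continuous_primitive (f : R -> R) : continuous f ->
  exists F : R -> R, forall t : R, is_derive t 1 F (f t).
Proof.
move=> cf.
pose I (a b : R) := \int[mu]_(t in `[a, b]) f t.
have chasles a b c : a <= b -> b <= c -> I a b + I b c = I a c.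
  move=> ab bc; rewrite /I -(Rintegral_itv_obnd_cbnd (r := b)); last first.
    by apply: (integrableS _ _ _ (continuous_integrable_cc b c cf)) => //;
       exact: subset_itv_oc_cc.
  rewrite -(@Rintegral_itvB _ f (BLeft a) (BRight c) b) ?bnd_simp //.
    by rewrite addrC subrK.
  exact: continuous_integrable_cc.
pose F t := if 0 <= t then I 0 t else - I t 0.
exists F => t.
pose a := - `|t| - 1.
have [ltat lta0] : a < t /\ a < 0.
  by split; rewrite /a; have := ler_norm (- t); rewrite normrN;
     have := normr_ge0 t; lra.
have [dI Iff] : derivable (I a) t 1 /\ (I a)^`()%classic t = f t.
  apply: (@continuous_FTC1_closed _ f a t (t + 1)) => //; last exact: cf.
  - by rewrite ltrDl.
  - exact: continuous_integrable_cc.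
have dG : is_derive t 1 (fun x => I a x - I a 0) (f t).
  have dI' : is_derive t 1 (I a) (f t).
    exact: DeriveDef dI (etrans (esym (derive1E _ _)) Iff).
  by have := is_deriveB dI' (is_derive_cst (I a 0) t 1); rewrite subr0.
apply: near_eq_is_derive dG.
near=> x; rewrite /F; have ax : a <= x by apply: ltW; near: x; exact: lt_nbhsr.
case: ifPn => [x0|].
  by rewrite -(chasles a 0 x) ?(ltW lta0) //; ring.
by rewrite -ltNge => /ltW x0; rewrite -(chasles a x 0) //; ring.
Unshelve. all: by end_near. Qed.

End Primitive.

(** * Length of curves on the unit sphere *)

Section Sphere.
Context {R : realType} {n : nat}.
Variables (e e' : R -> 'rV[R]_n) (L : R -> R).
Hypothesis de : forall t : R, is_derive t 1 e (e' t).
Hypothesis e1 : forall t, enorm (e t) = 1.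
Hypothesis dL : forall t : R, is_derive t 1 L (enorm (e' t)).

Lemma unit_field_dot_derive t : dot (e' t) (e t) = 0.
Proof.
have := is_derive_dot (de t) (de t).
under eq_fun do rewrite dot_unit //.
move=> /is_derive_derive1; rewrite derive1_cst [X in _ + X]dotC.
by move=> h; lra.
Qed.

(** Since [e' t] is orthogonal to [e t], only the component of [v]
    orthogonal to [e t] contributes to [<e' t, v>], and its squared norm is
    [1 - <e t, v> ^ 2]. *)
Lemma dot_tangent_le t (v : 'rV[R]_n) : enorm v = 1 ->
  dot (e' t) v ^+ 2 <= enorm (e' t) ^+ 2 * (1 - dot (e t) v ^+ 2).
Proof.
move=> v1.
have := dot_CauchySchwarz (e' t) (v - dot (e t) v *: e t).
rewrite !dotE unit_field_dot_derive (dotC v (e t)) enorm_sqr.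
rewrite (dot_unit v1) (dot_unit (e1 t)) mulr0 subr0 => /le_trans; apply.
by rewrite le_eqVlt; apply/orP; left; apply/eqP; ring.
Qed.

(** In the limit [r -> 1] this says that the angle between [e t] and a fixed
    vector [v] grows at most at the speed of [e].  The derivative of
    [asin (r f)] is [r f' / sqrt (1 - r^2 f^2)], and [dot_tangent_le] bounds
    it since [r^2 (1 - f^2) <= 1 - r^2 f^2]. *)
Lemma asin_dot_homo (v : 'rV[R]_n) (r : R) : enorm v = 1 -> 0 <= r < 1 ->
  {homo (fun t => asin (r * dot (e t) v) + L t) : x y / x <= y}.
Proof.
move=> v1 /andP[r0 r1].
have df t := is_derive_dot (de t) (is_derive_cst v t 1).
pose q t := Num.sqrt (1 - (r * dot (e t) v) ^+ 2).
have rf t : -1 < r * dot (e t) v < 1.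
  by have /andP[] := dot_unit_le1 (e1 t) v1; nra.
have q2_gt0 t : 0 < 1 - (r * dot (e t) v) ^+ 2.
  by have /andP[] := rf t; nra.
have q_gt0 t : 0 < q t by rewrite sqrtr_gt0.
apply: (@is_derive_ge0_homo _ _
  (fun t => (q t)^-1 * (r * dot (e' t) v) + enorm (e' t))) => t.
  have drf : is_derive t 1 (fun x => r * dot (e x) v) (r * dot (e' t) v).
    have := is_deriveZ r (df t).
    move=> /is_derive_eq; apply.
    by rewrite dot0r addr0.
  have dasin := @is_derive1_comp _ asin (fun x => r * dot (e x) v) t _ _
    (is_derive1_asin (rf t)) drf.
  exact: (is_deriveD dasin (dL t)).
have p0 := enorm_ge0 (e' t).
suff : `|r * dot (e' t) v| <= enorm (e' t) * q t.
  rewrite ler_norml => /andP[h _].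
  by rewrite -(pmulr_rge0 _ (q_gt0 t)) mulrDr mulVKf ?gt_eqF //; nra.
rewrite -ler_sqr ?nnegrE ?mulr_ge0 ?(ltW (q_gt0 t)) // real_normK ?num_real //.
rewrite [leRHS]exprMn [q t ^+ 2]sqr_sqrtr ?(ltW (q2_gt0 t)) //.
have := dot_tangent_le t v1; have /andP[] := dot_unit_le1 (e1 t) v1.
set f := dot _ v; set p := dot _ v => f1 f2 h.
apply: (@le_trans _ _ (r ^+ 2 * (enorm (e' t) ^+ 2 * (1 - f ^+ 2)))).
  by rewrite exprMn; apply: ler_wpM2l h; exact: sqr_ge0.
have := sqr_ge0 (enorm (e' t)); set m := _ ^+ 2 => m0.
have r2 : r ^+ 2 <= 1 by nra.
have : m * (r ^+ 2) <= m by nra.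
nra.
Qed.

Lemma length_homo : {homo L : x y / x <= y}.
Proof. by apply: (is_derive_ge0_homo dL) => t; exact: enorm_ge0. Qed.

(** With [v = e a] and [r = sin x], [asin_dot_homo] gives
    [sin (x - D) <= sin x * <e a, e b>] for [x < pi / 2], where [D] is the
    length of the arc; the claim is the limit [x -> pi / 2].  It bounds the
    spherical distance between the end points by [D]. *)
Lemma cos_length_le a b : a <= b -> L b - L a <= pi ->
  cos (L b - L a) <= dot (e a) (e b).
Proof.
move=> ab; rewrite le_eqVlt => /predU1P[->|Dpi].
  by rewrite cospi; have /andP[] := dot_unit_le1 (e1 a) (e1 b).
have D0 : 0 <= L b - L a.
  by rewrite subr_ge0 length_homo.
set D := L b - L a in Dpi D0 *; set f := dot _ _.
have /andP[fN1 f1] : -1 <= f <= 1 := dot_unit_le1 (e1 a) (e1 b).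
have pi0 := pi_gt0 R.
pose G (x : R) := sin x * f - sin (x - D).
(* The bound x - D >= - pi / 2, needed to invert the sine, holds for x
   close to pi / 2 because D < pi; this is why D = pi was set apart. *)
suff : 0 <= G (pi / 2).
  rewrite /G sin_pihalf mul1r subr_ge0.
  by rewrite -opprB sinN sinBpihalf opprK.
have cG : {for pi / 2, continuous G}.
  apply: cvgB; first by apply: cvgMl; exact: continuous_sin.
  apply: continuous_comp; last exact: continuous_sin.
  by apply: cvgB; [exact: cvg_id|exact: cvg_cst].
apply: (cvgr_to_ge (F := (pi / 2)^'-) (cvg_at_left_filter cG)).
near=> x.
have x0 : 0 < x by near: x; apply: nbhs_left_gt; lra.
have xD : D - pi / 2 < x by near: x; apply: nbhs_left_gt; lra.
have xpi : x < pi / 2 by near: x; exact: nbhs_left_lt.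
have sx0 : 0 < sin x by apply: sin_gt0_pihalf; rewrite x0.
have sx1 : sin x < 1 by rewrite -[ltRHS]sin_pihalf ltr_sin // in_itv /=; lra.
have /= := @asin_dot_homo (e a) (sin x) (e1 a) _ a b ab.
rewrite (ltW sx0) sx1 => /(_ isT).
rewrite dot_unit // mulr1 sinK; last by rewrite in_itv /=; lra.
rewrite dotC -/f => h.
have sf : -1 <= sin x * f <= 1 by nra.
rewrite /G subr_ge0 leNgt -[X in X < _]asinK ?in_itv //= ltr_sin.
- by rewrite -leNgt /D; lra.
- by rewrite in_itv /= asin_geNpi2 ?asin_lepi2.
- by rewrite in_itv /=; lra.
Unshelve. all: by end_near. Qed.

End Sphere.

(** * Antipodal arcs of minimal length *)

Section GreatCircle.
Context {R : realType} {n : nat}.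
Variables (e e' : R -> 'rV[R]_n) (L : R -> R).
Hypothesis de : forall t : R, is_derive t 1 e (e' t).
Hypothesis e1 : forall t, enorm (e t) = 1.
Hypothesis dL : forall t : R, is_derive t 1 L (enorm (e' t)).
Let cos_le := cos_length_le de e1 dL.
Let length_homo := length_homo dL.

Lemma antipodal_length_ge a b : a <= b -> e b = - e a -> pi <= L b - L a.
Proof.
move=> ab eab; rewrite leNgt; apply/negP => Dpi.
have := cos_le ab (ltW Dpi); rewrite eab dotNr dot_unit // -cospi leNgt.
rewrite ltr_cos ?Dpi // in_itv /= ?pi_ge0 ?lexx //.
by rewrite subr_ge0 length_homo // ltW.
Qed.

(** The second vector of the great circle is the value of [e] at the middle
    [m] of the arc, measured by length.  The comparison with both ends shows
    that [<e t, e a>] is the cosine of the length, and the comparison with the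
    middle shows that [<e t, e m>] is at least its sine, which is nonnegative.
    As the squares of cosine and sine already add up to [1], the unit vector
    [e t] has no further component. *)
Lemma antipodal_geodesic a b : a <= b -> e b = - e a -> L b - L a = pi ->
  exists y : 'rV[R]_n, [/\ enorm y = 1, dot (e a) y = 0 &
    forall t, a <= t <= b ->
      e t = cos (L t - L a) *: e a + sin (L t - L a) *: y].
Proof.
move=> ab eab Lab; have pi0 := pi_gt0 R.
have eaP t : a <= t <= b -> dot (e t) (e a) = cos (L t - L a).
  move=> /andP[lat ltb].
  apply/eqP; rewrite eq_le; apply/andP; split; last first.
    rewrite dotC; apply: cos_le => //.
    by rewrite -Lab lerD2r length_homo.
  have Ltb : L b - L t = pi - (L t - L a) by rewrite -Lab; ring.
  have := cos_le ltb; rewrite eab dotNr Ltb cosB cospi sinpi mul0r addr0 mulN1r.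
  by rewrite lerN2; apply; rewrite gerBl subr_ge0 length_homo.
have [m mab Lm] : exists2 m, m \in `[a, b]%R & L m = L a + pi / 2.
  apply: IVT => //; first exact/continuous_subspaceT/(is_derive_continuous dL).
  have Lb : L b = L a + pi by rewrite -Lab; ring.
  by rewrite Lb ge_min le_max; apply/andP; split; apply/orP; [left|right]; lra.
rewrite in_itv /= in mab; have /andP[am mb] := mab.
have Lma : L m - L a = pi / 2 by rewrite Lm; ring.
exists (e m); split=> //; first by rewrite dotC eaP // Lma cos_pihalf.
move=> t /[dup] tab /andP[lat ltb].
have eamE : dot (e m) (e a) = 0 by rewrite eaP // Lma cos_pihalf.
have emP : sin (L t - L a) <= dot (e t) (e m).
  (* [L t - L m] is the oriented length to the middle; it lies between
     - pi / 2 and pi / 2, so the comparison applies on either side. *)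
  have LtE : L t - L m = (L t - L a) - pi / 2 by rewrite Lm; ring.
  have La := length_homo lat; have Lb := length_homo ltb.
  case: (leP t m) => [tm|/ltW mt].
    have := cos_le tm; rewrite -opprB LtE cosN cosBpihalf; apply.
    by lra.
  have := cos_le mt; rewrite dotC LtE cosBpihalf; apply.
  by lra.
have sin0 : 0 <= sin (L t - L a).
  by apply: sin_ge0_pi; have := length_homo lat; have := length_homo ltb; lra.
set w := _ + _; apply/eqP; rewrite -subr_eq0; apply/eqP/dot_eq0.
apply/eqP; rewrite eq_le dot_ge0 andbT /w !dotE.
rewrite !(dotC (e a)) !(dotC (e m) (e t)) eamE eaP // !dot_unit //.
have := cos2Dsin2 (L t - L a).
set c := cos _; set s := sin _ in emP sin0 * => cs.
rewrite !mulr0 !mulr1.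
have := ler_wpM2l sin0 emP; set p := dot _ _; nra.
Qed.

End GreatCircle.

(** * Antiperiodic fields *)

Section Antiperiodic.
Context {R : realType}.

Lemma is_derive_shiftr n (f : R -> 'rV[R]_n) (c t : R) D :
  is_derive (t + c) 1 f D -> is_derive t 1 (fun x => f (x + c)) D.
Proof.
move=> /is_derive_mxP h; apply/is_derive_mxP => i j.
have := @is_derive1_comp _ (fun x => f x i j) (fun x => x + c) t _ _ (h i j)
  (is_derive_shift t 1 c).
by rewrite mulr1.
Qed.

Lemma is_derive_shiftr1 (f : R -> R) (c t : R) D :
  is_derive (t + c) 1 f D -> is_derive t 1 (fun x => f (x + c)) D.
Proof.
move=> h.
have := @is_derive1_comp _ f (fun x => x + c) t _ _ h (is_derive_shift t 1 c).
by rewrite mulr1.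
Qed.

Lemma antiperiodic_derive n (e e' : R -> 'rV[R]_n) (c : R) :
  (forall t : R, is_derive t 1 e (e' t)) -> (forall t, e (t + c) = - e t) ->
  forall t, e' (t + c) = - e' t.
Proof.
move=> de ec t.
have := is_derive_shiftr (de (t + c)).
under eq_fun do rewrite ec.
move=> /is_derive_derive1 <-; apply: is_derive_derive1; exact: is_deriveN.
Qed.

Lemma shift_invariant_forall (P : R -> Prop) (c : R) : 0 < c ->
  (forall t, P t <-> P (t + c)) -> (forall t, 0 <= t <= c -> P t) ->
  forall t, P t.
Proof.
move=> c0 Pc P0 t.
have Pnat (m : nat) x : P x <-> P (x + m%:R * c).
  elim: m x => [|m IHm] x; first by rewrite mul0r addr0.
  by rewrite IHm Pc -addrA -{2}[c]mul1r -mulrDl natr1.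
pose k := Num.floor (t / c).
have /andP[kt tk] : k%:~R <= t / c < (k + 1)%:~R by rewrite floor_itv.
rewrite ler_pdivlMr // in kt; rewrite ltr_pdivrMr // intrD mulrDl mul1r in tk.
have Pk : P (t - k%:~R * c) by apply: P0; lra.
case: k kt tk Pk => m _ _.
  by rewrite (Pnat m (t - _)) /= subrK.
by rewrite NegzE mulrNz mulNr opprK -Pnat.
Qed.

(** The description over one period extends to the whole line: adding [c] to
    the parameter changes the sign of [e] and adds [pi] to the length [L],
    which changes the signs of its cosine and sine. *)
Lemma half_turn_great_circle n (e e' : R -> 'rV[R]_n) (L : R -> R) (c : R) :
  0 < c ->
  (forall t : R, is_derive t 1 e (e' t)) -> (forall t, enorm (e t) = 1) ->
  (forall t : R, is_derive t 1 L (enorm (e' t))) ->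
  (forall t, e (t + c) = - e t) -> L 0 = 0 -> L c = pi ->
  exists y : 'rV[R]_n, [/\ enorm y = 1, dot (e 0) y = 0 &
    forall t, e t = cos (L t) *: e 0 + sin (L t) *: y].
Proof.
move=> c0 de e1 dL ec L0 Lc.
have ec0 : e c = - e 0 by rewrite -[in LHS](add0r c).
have [|y [y1 ey eE]] := antipodal_geodesic de e1 dL (ltW c0) ec0.
  by rewrite Lc L0 subr0.
have Ldc t : L (t + c) = L t + pi.
  have dLc (x : R) : is_derive x 1 (fun x => L (x + c)) (enorm (e' x)).
    by apply: is_derive_shiftr1; rewrite -enormN -(antiperiodic_derive de ec).
  have := is_derive_eq_sub dLc dL t 0; rewrite add0r Lc L0 subr0 => <-; ring.
exists y; split=> //; apply: (@shift_invariant_forall _ c) => // t.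
  rewrite Ldc ec cosDpi sinDpi !scaleNr -opprD; split=> [->//|].
  by move/oppr_inj.
by move=> /eE; rewrite L0 subr0.
Qed.

End Antiperiodic.

(** * Orthonormal frames and isometric embeddings *)

Section Frames.
Context {R : realType}.

Lemma forall_ord2 (P : 'I_2 -> Prop) : P 0 -> P 1 -> forall i, P i.
Proof.
move=> P0 P1 i; have [->//|->//] : i = 0 \/ i = 1.
by case: i => [[|[|//]] ?]; [left|right]; exact: val_inj.
Qed.

Lemma dot2E (u v : 'rV[R]_2) : dot u v = u 0 0 * v 0 0 + u 0 1 * v 0 1.
Proof.
rewrite /dot !big_ord_recl big_ord0 addr0.
by congr (_ + u 0 _ * v 0 _); exact: val_inj.
Qed.

Lemma mulmx_row2 n (u : 'rV[R]_2) (B : 'M[R]_(2, n)) :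
  u *m B = u 0 0 *: row 0 B + u 0 1 *: row 1 B.
Proof.
rewrite mulmx_sum_row !big_ord_recl big_ord0 addr0.
by congr (_ + u 0 _ *: row _ B); exact: val_inj.
Qed.

Lemma mulmx_tr_row m n (u : 'rV[R]_n) (B : 'M[R]_(m, n)) i :
  (u *m B^T) 0 i = dot u (row i B).
Proof. by rewrite mxE; apply: eq_bigr => k _; rewrite !mxE. Qed.

Lemma mulmx_tr_dot m n (B : 'M[R]_(m, n)) i j :
  (B *m B^T) i j = dot (row i B) (row j B).
Proof. by rewrite mxE; apply: eq_bigr => k _; rewrite !mxE. Qed.

Lemma orthonormal_frame n (a b : 'rV[R]_n) :
  enorm a = 1 -> enorm b = 1 -> dot a b = 0 ->
  exists B : 'M[R]_(2, n), [/\ B *m B^T = 1%:M, row 0 B = a & row 1 B = b].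
Proof.
move=> a1 b1 ab.
pose B : 'M[R]_(2, n) := \matrix_(i < 2) (if i == 0 then a else b).
have B0 : row 0 B = a by rewrite rowK.
have B1 : row 1 B = b by rewrite rowK.
exists B; split=> //; apply/matrixP => i j; rewrite mulmx_tr_dot [RHS]mxE.
by move: i j; do 2![apply: forall_ord2]; rewrite ?B0 ?B1 ?dot_unit // dotC.
Qed.

Variables (m n : nat) (B : 'M[R]_(m, n)).
Hypothesis BBt : B *m B^T = 1%:M.

Lemma dot_frame (x y : 'rV[R]_m) : dot (x *m B) (y *m B) = dot x y.
Proof. by rewrite dot_mulmx -mulmxA BBt mulmx1. Qed.

Lemma enorm_frame (x : 'rV[R]_m) : enorm (x *m B) = enorm x.
Proof. by rewrite !enormE dot_frame. Qed.

Lemma rank_frame : \rank B = m.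
Proof.
apply/eqP; rewrite eqn_leq rank_leq_row /=.
by rewrite -{1}(mxrank1 R m) -BBt mxrankM_maxl.
Qed.

End Frames.

(** By polarization [psi x = phi x - phi 0] preserves inner products.  Then
    the images of the standard basis are orthonormal rows of a matrix [A], and
    expanding [|psi x - x A|^2] gives [0]. *)
Lemma isometry_affine (R : realType) (m n : nat) (phi : 'rV[R]_m -> 'rV[R]_n) :
  (forall x y, enorm (phi x - phi y) = enorm (x - y)) ->
  exists2 A : 'M[R]_(m, n), A *m A^T = 1%:M & forall x, phi x = phi 0 + x *m A.
Proof.
move=> iso; pose psi x := phi x - phi 0.
have phiE x : phi x = phi 0 + psi x by rewrite addrC subrK.
have psi_norm x : dot (psi x) (psi x) = dot x x.
  by rewrite -!enorm_sqr iso subr0.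
have psiB x y : dot (psi x - psi y) (psi x - psi y) = dot (x - y) (x - y).
  by rewrite /psi opprB addrA subrK -!enorm_sqr iso.
clearbody psi.
have psi_dot x y : dot (psi x) (psi y) = dot x y.
  have := psiB x y.
  rewrite !dotE !psi_norm (dotC (psi y)) (dotC y); lra.
pose A := \matrix_(i < m) psi (delta_mx 0 i).
have dot_delta (x : 'rV[R]_m) i : dot x (delta_mx 0 i) = x 0 i.
  rewrite /dot (bigD1 i) //= big1 => [|j ji].
    by rewrite mxE !eqxx mulr1 addr0.
  by rewrite mxE (negbTE ji) andbF mulr0.
have AAt : A *m A^T = 1%:M.
  apply/matrixP => i j; rewrite mulmx_tr_dot !rowK psi_dot dot_delta !mxE /=.
  by rewrite eq_sym.
have psiAt x : psi x *m A^T = x.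
  by apply/rowP => i; rewrite mulmx_tr_row rowK psi_dot dot_delta.
exists A => // x; rewrite phiE; congr (_ + _); apply/eqP; rewrite -subr_eq0.
have cross : dot (psi x) (x *m A) = dot x x by rewrite dotC dot_mulmx psiAt.
apply/eqP/dot_eq0.
by rewrite !dotE (dotC (x *m A) (psi x)) cross psi_norm dot_frame //; ring.
Qed.

Section Collinear.
Context {R : realType} {n : nat}.

Lemma not_free2P (u v : 'rV[R]_n) : v != 0 ->
  reflect (exists a, u = a *: v) (~~ free [:: u; v]).
Proof.
move=> v0; rewrite free_cons seq1_free v0 andbT negbK span_seq1.
exact: vlineP.
Qed.

Lemma enorm1_neq0 (v : 'rV[R]_n) : enorm v = 1 -> v != 0.
Proof.
move=> v1; apply/eqP => v0; move: v1; rewrite v0 enormE dot0r sqrtr0.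
by move=> /eqP; rewrite eq_sym oner_eq0.
Qed.

End Collinear.

(** * Curvature of plane tangent fields *)

Section Kappa.
Context {R : realType}.

Lemma det_mx2E (M : 'M[R]_2) : \det M = M 0 0 * M 1 1 - M 0 1 * M 1 0.
Proof.
rewrite (expand_det_row _ 0) !big_ord_recl big_ord0 addr0 /cofactor !det_mx11.
rewrite !mxE /= expr0 expr1 mul1r mulN1r mulrN.
by congr (M _ _ * M _ _ - M _ _ * M _ _); exact: val_inj.
Qed.

Lemma kappa_tildeE (u : R -> 'rV[R]_2) t :
  kappa_tilde u t =
    u t 0 0 * u^`()%classic t 0 1 - u t 0 1 * u^`()%classic t 0 0.
Proof.
rewrite /kappa_tilde.
set M := (X in \det X); set v := u^`()%classic t.
have M0 j : M 0 j = u t 0 j.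
  have -> : (0 : 'I_2) = lshift 1 (0 : 'I_1) by exact: val_inj.
  by rewrite col_mxEu.
have M1 j : M 1 j = v 0 j.
  have -> : (1 : 'I_2) = rshift 1 (0 : 'I_1) by exact: val_inj.
  by rewrite col_mxEd.
by rewrite det_mx2E !M0 !M1.
Qed.

Definition quarter_turn : 'M[R]_2 :=
  \matrix_(i, j) (if i == j then 0 else if i == 0 then 1 else -1).

(** As an inner product of smooth fields the signed curvature is visibly
    smooth. *)
Lemma kappa_tilde_dot (u : R -> 'rV[R]_2) t :
  kappa_tilde u t = dot (u t *m quarter_turn) (u^`()%classic t).
Proof.
by rewrite kappa_tildeE dot2E !mulmx_row2 !mxE /=; ring.
Qed.

(** The derivative of a unit field is orthogonal to it, so in the plane its
    length is the area that it spans with the field. *)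
Lemma enorm_derive_kappa (u : R -> 'rV[R]_2) t :
  (forall t, enorm (u t) = 1) -> smooth u ->
  enorm (u^`()%classic t) = `|kappa_tilde u t|.
Proof.
move=> u1 su.
have uu' := unit_field_dot_derive (fun t => smooth_is_derive t su) u1 t.
have uu := dot_unit (u1 t).
rewrite enormE -sqrtr_sqr kappa_tildeE; congr Num.sqrt.
rewrite !dot2E in uu uu' *.
set a := u t 0 0 in uu uu' *; set b := u t 0 1 in uu uu' *.
set c := _ 0 0 in uu' *; set d := _ 0 1 in uu' *.
have : (c * a + d * b) ^+ 2 = 0 by rewrite uu' expr0n.
have : (a * a + b * b) * (c * c + d * d) = c * c + d * d by rewrite uu mul1r.
by move=> <- h; apply/eqP; rewrite -subr_eq0 -h; apply/eqP; ring.
Qed.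

Lemma kappa_polar (u : R -> 'rV[R]_2) (theta : R -> R) (t dtheta : R) :
  smooth u -> is_derive t 1 theta dtheta ->
  (\forall x \near t, u x 0 0 = cos (theta x) /\ u x 0 1 = sin (theta x)) ->
  kappa_tilde u t = dtheta.
Proof.
move=> su dt uE.
have /is_derive_mxP du := smooth_is_derive t su.
have [u0 u1] := nbhs_singleton uE.
have d0 : is_derive t 1 (fun x => u x 0 0) (- sin (theta t) * dtheta).
  apply: near_eq_is_derive
    (@is_derive1_comp _ cos theta t _ _ (is_derive_cos _) dt).
  by apply: filterS uE => x [].
have d1 : is_derive t 1 (fun x => u x 0 1) (cos (theta t) * dtheta).
  apply: near_eq_is_derive
    (@is_derive1_comp _ sin theta t _ _ (is_derive_sin _) dt).
  by apply: filterS uE => x [].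
rewrite kappa_tildeE u0 u1.
have -> : u^`()%classic t 0 0 = - sin (theta t) * dtheta.
  by rewrite -(is_derive_derive1 (du 0 0)) (is_derive_derive1 d0).
have -> : u^`()%classic t 0 1 = cos (theta t) * dtheta.
  by rewrite -(is_derive_derive1 (du 0 1)) (is_derive_derive1 d1).
transitivity ((cos (theta t) ^+ 2 + sin (theta t) ^+ 2) * dtheta).
  by ring.
by rewrite cos2Dsin2 mul1r.
Qed.

End Kappa.

(** * The lower bound for the total curvature *)

Section TotalCurvature.
Context {R : realType} {n : nat}.
Variable e : R -> 'rV[R]_n.
Hypothesis se : smooth e.

Lemma continuous_speed : continuous (fun t => enorm (e^`()%classic t)).
Proof.
under eq_fun do rewrite enormE.
move=> t; apply: (@continuous_comp _ _ _
  (fun t => dot (e^`()%classic t) (e^`()%classic t)) Num.sqrt).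
  have de' t := smooth_is_derive t (smooth_derive1 se).
  exact: is_derive_continuous (fun t => is_derive_dot (de' t) (de' t)) t.
exact: sqrt_continuous.
Qed.

Lemma arc_length_primitive : exists2 L : R -> R, L 0 = 0 &
  forall t : R, is_derive t 1 L (enorm (e^`()%classic t)).
Proof.
have [F dF] := continuous_primitive continuous_speed.
exists (fun t => F t - F 0) => [|t]; first by rewrite subrr.
by have := is_deriveB (dF t) (is_derive_cst (F 0) t 1); rewrite subr0.
Qed.

Lemma total_abs_curvatureE (L : R -> R) : continuous L ->
  (forall t : R, 0 < t < 2 * pi -> is_derive t 1 L (enorm (e^`()%classic t))) ->
  total_abs_curvature e = L (2 * pi) - L 0.
Proof.
move=> cL dL; rewrite /total_abs_curvature (@Rintegral_is_derive _ _ L) //.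
- by rewrite mulr_gt0 ?pi_gt0.
- exact: continuous_speed.
Qed.

Lemma antipodal_curvature_ge :
  (forall t, enorm (e t) = 1) -> non_co_orientable e ->
  pi <= total_abs_curvature e.
Proof.
move=> e1 ec; have [L L0 dL] := arc_length_primitive.
rewrite (total_abs_curvatureE (is_derive_continuous dL)) //.
apply: (antipodal_length_ge (fun t => smooth_is_derive t se) e1 dL).
  by rewrite mulr_ge0 ?pi_ge0.
by rewrite -[X in e X](add0r (2 * pi)) ec.
Qed.

End TotalCurvature.

(** * The case of equality *)

Section PlaneOfFrame.
Context {R : realType} {n : nat}.
Variables (p : 'rV[R]_n) (B : 'M[R]_(2, n)).
Hypothesis BBt : B *m B^T = 1%:M.

Lemma frame_isometric_identification :
  isometric_identification (fun x => p + x *m B) [set x | (x - p <= B)%MS].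
Proof.
split=> [x y|].
  by rewrite opprD addrACA subrr add0r -mulmxBl enorm_frame.
apply/seteqP; split=> [_ [x _ <-] /=|y /= /submxP[x yE]].
  by rewrite addrC addKr submxMl.
by exists x => //; rewrite -yE addrC subrK.
Qed.

End PlaneOfFrame.

Section Minimal.
Context {R : realType} {n : nat}.
Variables (gamma e : R -> 'rV[R]_n).
Hypothesis hgamma : closed_frontal gamma.
Hypothesis he : unit_tangent gamma e.
Hypothesis hnc : non_co_orientable e.

Let sg : smooth gamma. Proof. by case: hgamma => -[[]]. Qed.
Let se : smooth e. Proof. by case: he. Qed.
Let e1 t : enorm (e t) = 1. Proof. by case: he. Qed.

Lemma velocity_tangent t : exists a, gamma^`()%classic t = a *: e t.
Proof. by case: he => _ _ /(_ t) /not_free2P; apply; exact: enorm1_neq0. Qed.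

Section Projection.
Variable B : 'M[R]_(2, n).
Hypothesis BBt : B *m B^T = 1%:M.
Hypothesis eB : forall t, e t *m B^T *m B = e t.
Let c := fun t => gamma t *m B^T.
Let u := fun t => e t *m B^T.

Lemma velocity_in_frame t :
  gamma^`()%classic t *m B^T *m B = gamma^`()%classic t.
Proof.
by have [a ->] := velocity_tangent t; rewrite -!scalemxAl eB.
Qed.

(** The component of [gamma] orthogonal to the frame has derivative zero,
    because the velocity is a multiple of [e]. *)
Lemma frontal_in_plane t :
  gamma 0 - gamma 0 *m B^T *m B + c t *m B = gamma t.
Proof.
pose D := 1%:M - B^T *m B.
have dD (s : R) : is_derive s 1 (fun s => gamma s *m D) 0.
  have := is_derive_mulmxr D (smooth_is_derive s sg).
  by rewrite mulmxBr mulmx1 mulmxA velocity_in_frame subrr.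
have gD s : gamma s *m D = gamma s - gamma s *m B^T *m B.
  by rewrite mulmxBr mulmx1 mulmxA.
have -> : gamma 0 - gamma 0 *m B^T *m B = gamma t - gamma t *m B^T *m B.
  rewrite -!gD; apply/matrixP => i j.
  apply: (@is_derive_0_is_cst _ (fun s => (gamma s *m D) i j)) => s.
  by have /is_derive_mxP /(_ i j) := dD s; rewrite mxE.
exact: subrK.
Qed.

Lemma projected_frontal :
  [/\ closed_frontal c, unit_tangent c u & non_co_orientable u].
Proof.
have uc : unit_tangent c u.
  split; first exact: smooth_mulmxr.
    by move=> t; rewrite -(enorm_frame BBt) eB.
  move=> t; apply/not_free2P.
    by apply: enorm1_neq0; rewrite -(enorm_frame BBt) eB.
  have [a ga] := velocity_tangent t.
  by exists a; rewrite derive1_mulmxr // ga -scalemxAl.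
split=> //; last by move=> t; rewrite /u hnc mulNmx.
split; last by move=> t; rewrite /c (proj2 hgamma).
split; last by exists u.
split; first exact: smooth_mulmxr.
have [[[_ dense_reg] _] _] := hgamma.
move=> O O0 oO; have [t [Ot /= gt]] := dense_reg O O0 oO.
exists t; split=> //=; apply: contra_neq gt => ct.
rewrite -velocity_in_frame -[X in X *m B](derive1_mulmxr B^T t sg) ct.
exact: mul0mx.
Qed.

End Projection.

(** Since the coordinates of [e] in the frame are [cos (L t)] and
    [sin (L t)], the length [L] is an angle function.  It is smooth although
    it is only a primitive of a norm, because that norm is the signed
    curvature. *)
Lemma minimal_curvature_planar : total_abs_curvature e = pi ->
  exists P : set 'rV[R]_n,
     [/\ affine_plane P,
         (forall t, P (gamma t)) &
         exists (phi : 'rV[R]_2 -> 'rV[R]_n) (c u : R -> 'rV[R]_2),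
           [/\ isometric_identification phi P,
               (forall t, phi (c t) = gamma t),
               [/\ closed_frontal c, unit_tangent c u & non_co_orientable u],
               locally_L_convex u &
               rotation_index u (1 / 2) \/ rotation_index u (- (1 / 2))]].
Proof.
have [L L0 dL] := arc_length_primitive se.
rewrite (total_abs_curvatureE se (is_derive_continuous dL)) // L0 subr0 => Lpi.
have pi2 : 0 < 2 * pi :> R by rewrite mulr_gt0 ?pi_gt0.
have de t := smooth_is_derive t se.
have [y [y1 ey eE]] := half_turn_great_circle pi2 de e1 dL hnc L0 Lpi.
have [B [BBt B0 B1]] := orthonormal_frame (e1 0) y1 ey.
pose u t := e t *m B^T.
have u0 t : u t 0 0 = cos (L t).
  rewrite mulmx_tr_row B0 eE !dotE (dot_unit (e1 0)) dotC ey.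
  by rewrite mulr0 addr0 mulr1.
have u1 t : u t 0 1 = sin (L t).
  by rewrite mulmx_tr_row B1 eE !dotE (dot_unit y1) ey mulr0 add0r mulr1.
have eB t : e t *m B^T *m B = e t.
  by rewrite mulmx_row2 -/(u t) u0 u1 B0 B1 -eE.
have su : smooth u by exact: smooth_mulmxr.
have kappaE t : kappa_tilde u t = enorm (e^`()%classic t).
  by apply: (kappa_polar su (dL t)); near=> x; split.
pose p := gamma 0 - gamma 0 *m B^T *m B.
exists [set x | (x - p <= B)%MS]; split.
- by exists p, B; rewrite rank_frame.
- by move=> t /=; rewrite -(frontal_in_plane eB t) addrC addKr submxMl.
exists (fun x => p + x *m B), (fun t => gamma t *m B^T), u; split.
- exact: frame_isometric_identification.
- exact: frontal_in_plane.
- exact: projected_frontal.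
- by left=> t; rewrite kappaE enorm_ge0.
- left; exists L; split=> //.
  + apply: (@smooth_primitive _ _
      (fun t => dot (u t *m quarter_turn) (u^`()%classic t))).
      by move=> t; rewrite -kappa_tilde_dot kappaE.
    by apply: smooth_dot; [exact: smooth_mulmxr|exact: smooth_derive1].
  + by rewrite L0 Lpi subr0 mulrC mul1r mulKf.
Unshelve. all: by end_near. Qed.

(** Let [A] be the linear part of [phi] and [s = <e, u A>].  At regular points
    [e] and [u A] are unit vectors on the line of the velocity, so [s^2 = 1];
    by density this holds everywhere, and [2 s s' = 0] makes [s] constant.
    Hence [e = s u A], and the speeds agree. *)
Lemma unit_tangent_isometry (phi : 'rV[R]_2 -> 'rV[R]_n) (c u : R -> 'rV[R]_2) :
  (forall x y, enorm (phi x - phi y) = enorm (x - y)) ->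
  (forall t, phi (c t) = gamma t) -> smooth c -> unit_tangent c u ->
  forall t, enorm (e^`()%classic t) = enorm (u^`()%classic t).
Proof.
move=> iso phic sc [su u1 uc].
have [A AAt phiE] := isometry_affine iso.
have dg t : gamma^`()%classic t = c^`()%classic t *m A.
  apply: is_derive_derive1.
  have -> : gamma = (fun t => phi 0 + c t *m A).
    by apply/funext => x; rewrite -phic phiE.
  have := is_derive_mulmxr A (smooth_is_derive t sc).
  by move=> /(is_deriveD (is_derive_cst (phi 0) t 1)); rewrite add0r.
have uA1 t : enorm (u t *m A) = 1 by rewrite enorm_frame.
pose s t := dot (e t) (u t *m A).
have ds (t : R) := is_derive_dot (smooth_is_derive t se)
  (is_derive_mulmxr A (smooth_is_derive t su)).
have cs : continuous s := is_derive_continuous ds.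
have s_reg t : gamma^`()%classic t != 0 -> s t ^+ 2 = 1.
  have [a ga] := velocity_tangent t; rewrite ga => gt0.
  have a0 : a != 0 by apply: contra_neq gt0 => ->; rewrite scale0r.
  have [b cb] : exists b, c^`()%classic t = b *: u t.
    by apply/not_free2P => //; exact: enorm1_neq0.
  have gab : a *: e t = b *: (u t *m A) by rewrite -ga dg cb scalemxAl.
  have as_b : a * s t = b.
    by rewrite -dotZl gab dotZl dot_unit // mulr1.
  have bs_a : b * s t = a.
    by rewrite /s dotC -dotZl -gab dotZl dot_unit // mulr1.
  by apply: (mulfI a0); rewrite expr2 mulrA as_b bs_a mulr1.
have s_sqr t : s t ^+ 2 = 1.
  have [[[_ dense_reg] _] _] := hgamma.
  apply: contrapT => st.
  have cs2 : continuous (fun t => s t ^+ 2).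
    by move=> x; apply: cvgM; exact: cs.
  have := dense_reg [set t | s t ^+ 2 != 1].
  case; first by exists t; exact/eqP.
    apply: (@open_comp _ _ (fun t => s t ^+ 2) [set x | x != 1]).
      by move=> x _; exact: cs2.
    exact: open_neq.
  by move=> x [/= /eqP + /s_reg].
have s_cst t : s t = s 0.
  apply: is_derive_0_is_cst => x.
  have := is_deriveM (ds x) (ds x).
  rewrite (_ : _ * _ = cst 1); last first.
    by apply/funext => y; rewrite -[RHS](s_sqr y).
  move=> /[dup] /is_derive_derive1; rewrite derive1_cst => /esym/eqP.
  rewrite -mulr2n mulrn_eq0 /= scaler_eq0 => /orP[] /eqP sx0 _.
    by have := s_sqr x; rewrite /s sx0 expr0n => /eqP; rewrite eq_sym oner_eq0.
  by rewrite -sx0; exact: ds.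
have eE t : e t = s 0 *: (u t *m A).
  apply/eqP; rewrite -subr_eq0; apply/eqP/dot_eq0.
  rewrite !dotE (dotC _ (e t)) -/(s t) !dot_unit // s_cst.
  by have := s_sqr 0; lra.
move=> t.
have -> : e^`()%classic t = s 0 *: (u^`()%classic t *m A).
  apply: is_derive_derive1.
  have -> : e = (fun t => s 0 *: (u t *m A)) by apply/funext.
  exact: is_deriveZ (is_derive_mulmxr A (smooth_is_derive t su)).
by rewrite !enormE !dotE mulrA -expr2 s_sqr mul1r dot_frame.
Qed.

(** Local L-convexity turns the integral into the increment of the angle, up
    to the sign of the curvature; the rotation index carries a sign as well.
    The product of the two signs is positive because a total curvature is
    nonnegative. *)
Lemma planar_convex_curvature (phi : 'rV[R]_2 -> 'rV[R]_n)
    (c u : R -> 'rV[R]_2) :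
  (forall x y, enorm (phi x - phi y) = enorm (x - y)) ->
  (forall t, phi (c t) = gamma t) -> smooth c -> unit_tangent c u ->
  locally_L_convex u ->
  rotation_index u (1 / 2) \/ rotation_index u (- (1 / 2)) ->
  total_abs_curvature e = pi.
Proof.
move=> iso phic sc hu conv rot.
have speed := unit_tangent_isometry iso phic sc hu.
have [su u1 _] := hu.
have [theta [r [sth uth rth r12]]] : exists (theta : R -> R) r,
    [/\ smooth (theta : R -> R^o),
        forall t, 0 <= t <= 2 * pi ->
          u t 0 0 = cos (theta t) /\ u t 0 1 = sin (theta t),
        2 * pi * r = theta (2 * pi) - theta 0 & `|r| = 1 / 2].
  case: rot => -[theta [? ? ?]]; [exists theta, (1/2)|exists theta, (- (1/2))].
    by split=> //; rewrite ger0_norm //; lra.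
  by split=> //; rewrite normrN ger0_norm //; lra.
have dth t := smooth_is_derive t sth.
have kappaE t : 0 < t < 2 * pi -> kappa_tilde u t = theta^`()%classic t.
  move=> /andP[t0 t2]; apply: (kappa_polar su (dth t)).
  near=> x; apply: uth; apply/andP; split; apply: ltW.
    by near: x; exact: lt_nbhsr.
  by near: x; exact: lt_nbhsl.
have [sgn [sgn1 kappa_abs]] : exists sgn : R, `|sgn| = 1 /\
    forall t, `|kappa_tilde u t| = sgn * kappa_tilde u t.
  case: conv => h; [exists 1|exists (-1)]; rewrite ?normrN normr1; split=> // t.
    by rewrite mul1r ger0_norm.
  by rewrite mulN1r ler0_norm.
have K : total_abs_curvature e = sgn * (theta (2 * pi) - theta 0).
  rewrite mulrBr.
  apply: (@total_abs_curvatureE _ _ _ se (fun t => sgn * theta t)).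
    move=> t; apply: cvgMr.
    exact: is_derive_continuous dth t.
  move=> t t2; rewrite speed enorm_derive_kappa // kappa_abs kappaE //.
  exact: is_deriveZ.
have pi0 := pi_gt0 R.
have K0 : 0 <= total_abs_curvature e.
  exact: le_trans (ltW pi0) (antipodal_curvature_ge se e1 hnc).
rewrite -(ger0_norm K0) K normrM sgn1 -rth !normrM r12 !ger0_norm ?ltW //.
by rewrite mul1r mulrAC mulrC; lra.
Unshelve. all: by end_near. Qed.

End Minimal.

Theorem theorem1 (R : realType) (n : nat) (hn : (2 <= n)%N)
    (gamma e : R -> 'rV[R]_n) (hgamma : closed_frontal gamma)
    (he : unit_tangent gamma e) (hnc : non_co_orientable e) :
  pi <= total_abs_curvature e /\
  (total_abs_curvature e = pi <->
   exists P : set 'rV[R]_n,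
     [/\ affine_plane P,
         (forall t, P (gamma t)) &
         exists (phi : 'rV[R]_2 -> 'rV[R]_n) (c u : R -> 'rV[R]_2),
           [/\ isometric_identification phi P,
               (forall t, phi (c t) = gamma t),
               [/\ closed_frontal c, unit_tangent c u & non_co_orientable u],
               locally_L_convex u &
               rotation_index u (1 / 2) \/ rotation_index u (- (1 / 2))]]).
Proof.
split; first by have [se e1 _] := he; exact: antipodal_curvature_ge.
split; first exact: minimal_curvature_planar.
move=> [P [_ _ [phi [c [u [[iso _] phic [[[[sc _] _] _] uc _] conv rot]]]]]].
exact: planar_convex_curvature iso phic sc uc conv rot.
Qed.
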